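(* Let $n,q\ge 1$ and $r\ge 3$ be integers and let $\sigma$ be a partition of $r$ with $s(\sigma)\ge 2$ and $\delta(\sigma)\ge 2$. Then the $\sigma$-hypergraph $\mathcal{H}(n,r,q|\sigma)$ does not have a gap in its NMNR spectrum.
   Context: For positive integers $n,r,q$ with $r\ge 3$ and a partition $\sigma$ of the integer $r$ (into positive parts), the $\sigma$-hypergraph $\mathcal{H}(n,r,q|\sigma)$ has $nq$ vertices, partitioned into $n$ classes $V_1,\dots,V_n$ each containing $q$ vertices; an $r$-subset $R$ of the vertices is an edge if and only if the non-zero cardinalities among $|R\cap V_i|$, $1\le i\le n$, form (as a multiset) the partition $\sigma$ of $r$. $\delta(\sigma)$ and $s(\sigma)$ denote the size of the smallest part and the number of parts (counted with multiplicity) of $\sigma$, respectively. It is assumed throughout that $s(\sigma)\ge 2$. A $k$-NMNR (non-monochromatic non-rainbow) colouring of a hypergraph is a colouring of its vertices using exactly $k$ distinct colours (all $k$ are used) such that no edge has all its vertices of the same colour and no edge has all its vertices of pairwise distinct colours. A hypergraph is $k$-NMNR colourable if it has a $k$-NMNR colouring. Its NMNR spectrum is the set of all positive integers $k$ for which it is $k$-NMNR colourable; the spectrum has a gap if there are $k_1<k_2<k_3$ with $k_1,k_3$ in the spectrum and $k_2$ not in the spectrum. *)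

(* Defs.v *)
From mathcomp Require Import all_boot.

Set Implicit Arguments.
Unset Strict Implicit.
Unset Printing Implicit Defensive.

Definition is_intpart (r : nat) (sigma : seq nat) : bool :=
  [&& sorted geq sigma, all (ltn 0) sigma & sumn sigma == r].

(* The initial value of the iterated minimum is itself a part of sigma, so this
   is the minimum of the parts of any nonempty sigma. *)
Definition smallest_part (sigma : seq nat) : nat :=
  \big[minn/head 0 sigma]_(a <- sigma) a.

Definition num_parts (sigma : seq nat) : nat := size sigma.

Definition vertex (n q : nat) : finType := ('I_n * 'I_q)%type.

Definition vclass (n q : nat) (i : 'I_n) : {set vertex n q} :=
  [set v : vertex n q | v.1 == i].

Definition trace_sizes (n q : nat) (R : {set vertex n q}) : seq nat :=
  [seq a <- [seq #|R :&: vclass q i| | i <- enum 'I_n] | a != 0].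

Definition sigma_hypergraph (n r q : nat) (sigma : seq nat) :
    {set {set vertex n q}} :=
  [set R : {set vertex n q} | (#|R| == r) && perm_eq (trace_sizes R) sigma].

Section Colouring.

Variables (T C : finType).

Definition monochromatic (f : T -> C) (e : {set T}) : bool :=
  [forall x in e, forall y in e, f x == f y].

Definition rainbow (f : T -> C) (e : {set T}) : bool :=
  [forall x in e, forall y in e, (x != y) ==> (f x != f y)].

Definition uses_all_colours (f : T -> C) : bool :=
  [forall c, exists x, f x == c].

Definition NMNR_colouring (H : {set {set T}}) (f : T -> C) : bool :=
  uses_all_colours f &&
  [forall e in H, ~~ monochromatic f e && ~~ rainbow f e].

End Colouring.

Definition NMNR_colourable (T : finType) (H : {set {set T}}) (k : nat) : bool :=
  [exists f : {ffun T -> 'I_k}, NMNR_colouring H f].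

Definition NMNR_spectrum (T : finType) (H : {set {set T}}) : pred nat :=
  [pred k | (0 < k) && NMNR_colourable H k].

Definition has_gap (S : pred nat) : Prop :=
  exists k1 k2 k3 : nat,
    [/\ k1 < k2, k2 < k3, k1 \in S, k3 \in S & k2 \notin S].

(* Main.v *)
Require Import Defs.
From mathcomp Require Import all_boot.

(**
  Below n the spectrum is closed under successor: when k < n colours are used,
  some class has no colour of its own, and giving that whole class one new
  colour yields a (k+1)-colouring.  The new class meets no monochromatic edge
  because s >= 2, and no rainbow edge because every part is at least 2.

  Above n it is closed under predecessor.  One vertex of each colour, together
  with one vertex of every class missed so far, is a set S that meets every
  class and contains no edge: an edge inside S would be rainbow.  Conversely,
  any such S gives an NMNR colouring with #|S| colours, in which each class is
  coloured by its own vertices in S; and S may be shrunk down to n vertices.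
*)

Section ColouringFacts.

Variable T : finType.

Lemma monochromaticP (C : finType) (f : T -> C) (e : {set T}) :
  reflect {in e &, forall x y, f x = f y} (monochromatic f e).
Proof.
apply: (iffP forall_inP) => [H x y xe ye | H x xe].
  by move/forall_inP: (H x xe) => /(_ y ye) /eqP.
by apply/forall_inP => y ye; apply/eqP/H.
Qed.

Lemma rainbowP (C : finType) (f : T -> C) (e : {set T}) :
  reflect {in e &, injective f} (rainbow f e).
Proof.
apply: (iffP forall_inP) => [H x y xe ye fxy | H x xe].
  move/forall_inP: (H x xe) => /(_ y ye).
  by rewrite fxy eqxx implybF negbK => /eqP.
apply/forall_inP => y ye; apply/implyP; apply: contra => /eqP fxy.
by apply/eqP/H.
Qed.

(** Lets the constructions below take colours in any finite type, such as an option type or the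
    vertices themselves: only the colours attained count, and [enum_rank] renumbers them. *)
Lemma colourable_imset (C : finType) (H : {set {set T}}) (f : T -> C) :
    {in H, forall e, ~~ monochromatic f e && ~~ rainbow f e} ->
  NMNR_colourable H #|f @: [set: T]|.
Proof.
move=> fH; have fim x : f x \in f @: [set: T] by apply: imset_f; rewrite inE.
have cD : #|{: {y | y \in f @: [set: T]}}| = #|f @: [set: T]|.
  by rewrite card_sig; apply: eq_card.
rewrite -cD; set D : finType := sig (fun y => y \in f @: [set: T]).
pose h x : 'I_#|D| := enum_rank (exist _ (f x) (fim x) : D).
have hE x y : h x = h y <-> f x = f y.
  split; first by move/enum_rank_inj/(congr1 val).
  by move=> fxy; congr (enum_rank _); apply: val_inj.
apply/existsP; exists [ffun x => h x]; apply/andP; split.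
  apply/forallP => c; have /imsetP[x _ xc] := valP (enum_val c).
  apply/existsP; exists x; rewrite ffunE.
  by apply/eqP/enum_val_inj; rewrite enum_rankK; apply: val_inj.
apply/forall_inP => e /fH /andP[fm fr]; apply/andP; split.
  apply: contra fm => /monochromaticP hm; apply/monochromaticP => x y xe ye.
  by apply/hE; have := hm x y xe ye; rewrite !ffunE.
apply: contra fr => /rainbowP hr; apply/rainbowP => x y xe ye /hE hxy.
by apply: hr => //; rewrite !ffunE.
Qed.

End ColouringFacts.

Section SigmaHypergraph.

Variables (n r q : nat) (sigma : seq nat).
Hypothesis s_ge2 : 2 <= num_parts sigma.
Hypothesis delta_ge2 : 2 <= smallest_part sigma.

Notation vert := (vertex n q).
Notation H := (sigma_hypergraph n r q sigma).

Lemma smallest_part_le a : a \in sigma -> smallest_part sigma <= a.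
Proof.
(* The initial value must stay fixed while the list shrinks, so it is generalised before the
   induction. *)
rewrite /smallest_part; move: (head 0 sigma) => z.
elim: sigma => // b s IH; rewrite inE big_cons => /predU1P[-> | /IH].
  exact: geq_minl.
exact/leq_trans/geq_minr.
Qed.

Lemma edge_same_class e v :
  e \in H -> v \in e -> exists w, [/\ w \in e, w != v & w.1 = v.1].
Proof.
rewrite inE => /andP[_ /perm_mem trE] ve.
have vI : v \in e :&: vclass q v.1 by rewrite !inE ve eqxx.
have : #|e :&: vclass q v.1| \in sigma.
  rewrite -trE mem_filter -lt0n; apply/andP; split.
    by apply/card_gt0P; exists v.
  by apply: (map_f (fun i => #|e :&: vclass q i|)); rewrite mem_enum.
move=> /smallest_part_le /(leq_trans delta_ge2).
rewrite (cardsD1 v) vI ltnS => /card_gt0P[w].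
rewrite !inE => /andP[wv /andP[we /eqP wv1]].
by exists w.
Qed.

Lemma edge_two_classes e :
  e \in H -> exists v w, [/\ v \in e, w \in e & v.1 != w.1].
Proof.
rewrite inE => /andP[_ /perm_size trE].
have : 1 < #|[pred i | #|e :&: vclass q i| != 0]|.
  move: s_ge2; rewrite /num_parts -trE /trace_sizes filter_map size_map.
  by rewrite cardE {2}/enum_mem -enumT.
case/card_gt1P=> i [j] [].
rewrite !inE -!lt0n => /card_gt0P[v] + /card_gt0P[w].
rewrite !inE => /andP[ve /eqP vi] /andP[we /eqP wj] ij.
by exists v, w; rewrite vi wj.
Qed.

(** Such a map carries each trace of [e] bijectively onto the trace of the image in the same class.
    It will move a rainbow edge into a set of representatives. *)
Lemma imset_edge (g : vert -> vert) (e : {set vert}) :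
    (forall v, (g v).1 = v.1) -> {in e &, injective g} ->
  e \in H -> g @: e \in H.
Proof.
move=> g1 gI; rewrite !inE card_in_imset // => /andP[-> /=].
suff -> : trace_sizes (g @: e) = trace_sizes e by [].
congr filter; apply: eq_map => i.
have -> : g @: e :&: vclass q i = g @: (e :&: vclass q i).
  apply/setP => w; rewrite !inE; apply/andP/imsetP.
    by case=> /imsetP[v ve ->]; rewrite g1 => vi; exists v; rewrite ?inE ?ve.
  by case=> v; rewrite !inE => /andP[ve vi] ->; rewrite imset_f // g1.
by rewrite card_in_imset // => x y; rewrite !inE => /andP[xe _] /andP[ye _]; apply: gI.
Qed.

Lemma colourable_succ k :
  0 < q -> k < n -> NMNR_colourable H k -> NMNR_colourable H k.+1.
Proof.
move=> q_gt0 kn /existsP[f /andP[/forallP fS /forall_inP fH]].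
(* Every old colour must survive outside the class to be recoloured. If no class allowed this,
   picking for each class a colour confined to it would inject the [n] classes into [k] colours. *)
have [i /forallP iP] : exists i : 'I_n,
    [forall c, [exists v : vert, (v.1 != i) && (f v == c)]].
  apply/existsP; apply: contraTT kn => /existsPn private; rewrite -leqNgt.
  have /fin_all_exists [p pP] : forall i : 'I_n,
      exists c, forall v : vert, f v = c -> v.1 = i.
    move=> i; have /forallPn[c /existsPn cP] := private i.
    exists c => v vc; apply/eqP; apply: contraNT (cP v) => ->.
    by rewrite vc eqxx.
  have pI : injective p.
    move=> i j pij; have /existsP[v /eqP vp] := fS (p i).
    by rewrite -(pP i v vp); apply: pP; rewrite vp.
  by have := leq_card p pI; rewrite !card_ord.
pose g (v : vert) := if v.1 == i then None else Some (f v).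
have -> : k.+1 = #|g @: [set: vert]|.
  rewrite -[in LHS](card_ord k) -card_option -cardsT; apply: eq_card => c.
  rewrite inE; symmetry; apply/imsetP; case: c => [c|].
    have /existsP[v /andP[vi /eqP vc]] := iP c; exists v; rewrite ?inE //.
    by rewrite /g (negPf vi) vc.
  by exists (i, Ordinal q_gt0); rewrite ?inE // /g eqxx.
apply: colourable_imset => e eH; have /andP[fm fr] := fH e eH.
apply/andP; split.
  apply: contra fm => /monochromaticP gm; apply/monochromaticP => x y xe ye.
  have [v [w [ve we vw]]] := edge_two_classes e eH.
  (* A vertex of [e] in class [i] has colour [None], which would force all of [e] into that class.
     Off class [i], [g] is [f] up to [Some]. *)
  have out z : z \in e -> z.1 != i.
    move=> ze; apply: contraNneq vw => zi.
    have in_i u : u \in e -> u.1 = i.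
      by move=> ue; have := gm u z ue ze; rewrite /g zi eqxx; case: eqP.
    by rewrite !in_i.
  by have := gm x y xe ye; rewrite /g !(negPf (out _ _)) // => -[].
apply: contra fr => /rainbowP gr; apply/rainbowP => x y xe ye fxy.
(* A vertex of [e] in class [i] would have a companion there, also coloured [None]. *)
have out z : z \in e -> z.1 != i.
  move=> ze; have [w [we wz w1]] := edge_same_class e z eH ze.
  apply: contraNneq wz => zi.
  by apply/eqP/gr; rewrite // /g w1 zi eqxx.
by apply: gr; rewrite // /g !(negPf (out _ _)) // fxy.
Qed.

Definition independent_cover (S : {set vert}) :=
  (forall i : 'I_n, exists2 v, v \in S & v.1 = i) /\
  {in H, forall e : {set vert}, ~~ (e \subset S)}.

Lemma independent_cover_colourable S :
  independent_cover S -> NMNR_colourable H #|S|.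
Proof.
case=> /fin_all_exists2 [t tS t1] indS.
(* A class-preserving retraction onto [S], used as the colouring. The colour determines the class,
   so no edge is monochromatic; a rainbow edge would have an edge inside [S] as its image. *)
pose g (v : vert) := if v \in S then v else t v.1.
have g1 v : (g v).1 = v.1 by rewrite /g; case: ifP.
have gS v : g v \in S by rewrite /g; case: ifP.
have -> : S = g @: [set: vert].
  apply/setP => v; apply/idP/imsetP => [vS | [w _ ->] //].
  by exists v; rewrite ?inE // /g vS.
apply: colourable_imset => e eH; apply/andP; split.
  have [v [w [ve we]]] := edge_two_classes e eH.
  apply: contraNN => /monochromaticP /(_ v w ve we) gvw.
  by rewrite -g1 gvw g1.
apply/negP => /rainbowP gI; have /negP[] := indS _ (imset_edge g e g1 gI eH).
by apply/subsetP => _ /imsetP[v _ ->].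
Qed.

Lemma independent_cover_shrink k S :
    independent_cover S -> n <= k <= #|S| ->
  exists2 S', independent_cover S' & #|S'| = k.
Proof.
move=> SP /andP[nk]; move: {2}(#|S| - k) (erefl (#|S| - k)) => m.
elim: m S SP => [|m IH] S SP dm kS.
  by exists S => //; apply/eqP; rewrite eqn_leq kS -subn_eq0 dm eqxx.
have lt_kS : k < #|S| by rewrite -subn_gt0 dm.
have [x xS [y]] : exists2 x, x \in S & exists2 y, y \in [predD1 S & x] & x.1 = y.1.
  apply/dinjectivePn; apply: contraTN lt_kS => /dinjectiveP S1.
  rewrite -leqNgt (leq_trans _ nk) // -(card_in_imset S1).
  by rewrite (leq_trans (max_card _)) ?card_ord.
rewrite !inE => /andP[yx yS] xy; have Sx := cardsD1 x S.
rewrite xS add1n in Sx; rewrite Sx ltnS in lt_kS.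
apply: (IH (S :\ x)).
- split=> [i | e eH].
    have [v vS <-] := SP.1 i; have [->|vx] := eqVneq v x.
      by exists y; rewrite // !inE yx.
    by exists v; rewrite // !inE vx.
  by apply: contraNN (SP.2 e eH) => /subset_trans; apply; apply: subsetDl.
- by move: dm; rewrite Sx subSn // => -[].
- exact: lt_kS.
Qed.

Lemma colourable_independent_cover k :
    0 < q -> NMNR_colourable H k ->
  exists2 S, independent_cover S & k <= #|S|.
Proof.
move=> q_gt0 /existsP[f /andP[/forallP fS /forall_inP fH]].
have /fin_all_exists [rep repK] : forall c, exists x, f x = c.
  by move=> c; have /existsP[x /eqP] := fS c; exists x.
pose R := rep @: [set: 'I_k].
pose E := [set v : vert | (v.2 == Ordinal q_gt0) && (v.1 \notin fst @: R)].
exists (R :|: E); last first.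
  rewrite -[k in k <= _]card_ord -cardsT -(card_imset _ (can_inj repK)).
  exact/subset_leq_card/subsetUl.
split=> [i | e eH].
  have [/imsetP[v vR ->] | iR] := boolP (i \in fst @: R).
    by exists v; rewrite // inE vR.
  by exists (i, Ordinal q_gt0); rewrite // !inE eqxx iR orbT.
have /andP[_ fr] := fH e eH; apply: contraNN fr => /subsetP eS.
(* If [v] were in [E], its companion in the same class could lie neither in [R], which misses that
   class, nor in [E], which has at most one vertex per class. *)
have eR v : v \in e -> v \in R.
  move=> ve; have := eS v ve; rewrite inE => /orP[//|].
  rewrite inE => /andP[/eqP v2 vR].
  have [w [we wv w1]] := edge_same_class e v eH ve.
  have := eS w we; rewrite inE => /orP[wR | ].
    by case/negP: vR; rewrite -w1 imset_f.
  rewrite inE => /andP[/eqP w2 _]; case/eqP: wv.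
  by apply/eqP; rewrite -pair_eqE /= w1 w2 v2 !eqxx.
apply/rainbowP => x y /eR /imsetP[c _ ->] /eR /imsetP[d _ ->].
by rewrite !repK => ->.
Qed.

End SigmaHypergraph.

Theorem theorem3p9 (n q r : nat) (sigma : seq nat)
    (n_ge1 : 1 <= n) (q_ge1 : 1 <= q) (r_ge3 : 3 <= r)
    (sigmaP : is_intpart r sigma)
    (s_ge2 : 2 <= num_parts sigma)
    (delta_ge2 : 2 <= smallest_part sigma) :
  ~ has_gap (NMNR_spectrum (sigma_hypergraph n r q sigma)).
Proof.
case=> k1 [k2] [k3] [k12 k23]; rewrite !inE.
move=> /andP[k1_gt0 col1] /andP[_ col3].
rewrite (ltn_trans k1_gt0 k12) => /negP; apply.
(* Up to [n], climb from [k1] one colour at a time; beyond [n], shrink a cover obtained from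
   [k3]. *)
have [k2n | nk2] := leqP k2 n.
  elim: k2 k12 k2n {k23} => // k IH; rewrite ltnS leq_eqVlt.
  case/predU1P=> [<- | k1k] kn; apply: colourable_succ => //.
  exact: IH (ltnW kn).
have [S SP k3S] := colourable_independent_cover n r q sigma delta_ge2 k3 q_ge1 col3.
have [|S' S'P <-] := independent_cover_shrink n r q sigma k2 S SP.
  by rewrite (ltnW nk2) (leq_trans (ltnW k23)).
exact: independent_cover_colourable.
Qed.
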